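(* Let $(X,d)$ be a complete separable metric space and let $(\xi_j)_{j=1}^n$ be a time-homogeneous Markov process with state space $X$, initial distribution $P^{(1)}$ and transition kernel $p(\cdot\mid x)$. Suppose there exist constants $\kappa_1>0$ and $L\ge 0$ such that: (i) $P^{(1)}$ and every $p(\cdot\mid x)$ ($x\in X$) satisfy $GC(\kappa_1)$ on $(X,d)$; (ii) $x\mapsto p(\cdot\mid x)$ is $L$-Lipschitz from $(X,d)$ to $(\mathrm{Prob}_1(X),W_1)$, i.e. $W_1(p(\cdot\mid x),p(\cdot\mid y))\le L\,d(x,y)$ for all $x,y\in X$. Then the joint law $P^{(n)}$ of $(\xi_1,\dots,\xi_n)$ satisfies $GC(\kappa_n)$ on $(X^n,d^{(1)})$, where $$\kappa_n=\kappa_1\sum_{m=1}^{n}\Bigl(\sum_{k=0}^{m-1}L^k\Bigr)^2.$$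
   Context: $\mathrm{Prob}(X)$ is the set of Radon (Borel) probability measures on $X$. A measure $\mu\in\mathrm{Prob}(X)$ satisfies the Gaussian concentration inequality $GC(\kappa)$ on $(X,d)$ if $\int_X e^{tF}\,d\mu\le \exp\bigl(t\int_X F\,d\mu+\kappa t^2/2\bigr)$ for all $t\in\mathbb R$ and all $1$-Lipschitz $F:(X,d)\to\mathbb R$. For $1\le s<\infty$, $\mathrm{Prob}_s(X)$ is the set of $\nu\in\mathrm{Prob}(X)$ with $\int d(x_0,y)^s\nu(dy)<\infty$ for some (equivalently all) $x_0$, and $W_s(\mu,\nu)=\inf_\pi\bigl(\iint d(x,y)^s\pi(dx\,dy)\bigr)^{1/s}$, the infimum over couplings $\pi$ of $\mu$ and $\nu$. On $X^k$, $d^{(s)}(x^{(k)},y^{(k)})=(\sum_{j=1}^k d(x_j,y_j)^s)^{1/s}$. The joint law is $P^{(n)}(dx^{(n)})=p(dx_n\mid x_{n-1})\cdots p(dx_2\mid x_1)P^{(1)}(dx_1)$. *)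

(* Defs.v *)
From HB Require Import structures.
From mathcomp Require Import all_boot all_order all_algebra.
From mathcomp Require Import all_classical all_reals all_analysis measurable_realfun.
Set Implicit Arguments. Unset Strict Implicit. Unset Printing Implicit Defensive.
Import Order.TTheory GRing.Theory Num.Theory.
Local Open Scope classical_set_scope.
Local Open Scope ring_scope.

Section defs.
Context {R : realType}.

Definition is_metric {T : Type} (d : T -> T -> R) : Prop :=
  [/\ (forall x y, d x y = 0 <-> x = y),
      (forall x y, d x y = d y x) &
      (forall x y z, d x z <= d x y + d y z)].

Definition d_open {T : Type} (d : T -> T -> R) (A : set T) : Prop :=
  forall x, A x -> exists r : R, 0 < r /\ [set y | d x y < r] `<=` A.

Definition d_complete {T : Type} (d : T -> T -> R) : Prop :=
  forall u : nat -> T,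
    (forall e : R, 0 < e -> exists N, forall m n, (N <= m)%N -> (N <= n)%N -> d (u m) (u n) < e) ->
    exists l, forall e : R, 0 < e -> exists N, forall n, (N <= n)%N -> d (u n) l < e.

Definition d_separable {T : Type} (d : T -> T -> R) : Prop :=
  exists D : set T, countable D /\
    forall x (e : R), 0 < e -> exists y, D y /\ d x y < e.

Definition lipschitz_wrt {T : Type} (d : T -> T -> R) (c : R) (F : T -> R) : Prop :=
  forall x y, `|F x - F y| <= c * d x y.

Definition GC {dT} {T : measurableType dT} (d : T -> T -> R) (kappa : R)
    (mu : probability T R) : Prop :=
  forall F : T -> R, lipschitz_wrt d 1 F ->
    mu.-integrable setT (EFin \o F) /\
    forall t : R,
      (\int[mu]_x (expR (t * F x))%:E <=
        (expR (t * fine (\int[mu]_x (F x)%:E) + kappa * t ^+ 2 / 2))%:E)%E.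

Definition coupling {dT} {T : measurableType dT} (mu nu : probability T R)
    (pi : probability (T * T)%type R) : Prop :=
  (forall A, measurable A -> pi (A `*` setT) = mu A) /\
  (forall B, measurable B -> pi (setT `*` B) = nu B).

Definition W1 {dT} {T : measurableType dT} (d : T -> T -> R)
    (mu nu : probability T R) : \bar R :=
  ereal_inf [set (\int[pi]_z (d z.1 z.2)%:E)%E | pi in [set pi | coupling mu nu pi]].

Definition dsum {T : Type} (d : T -> T -> R) (n : nat) (x y : n.-tuple T) : R :=
  \sum_(i < n) d (tnth x i) (tnth y i).

Fixpoint rchain {dT} {T : measurableType dT} (p : T -> probability T R)
    (A : nat -> set T) (j m : nat) (x : T) : \bar R :=
  match m with
  | 0 => 1%E
  | m'.+1 => (\int[p x]_(y in A j) rchain p A j.+1 m' y)%E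
  end.

Definition joint_rect {dT} {T : measurableType dT} (P1 : probability T R)
    (p : T -> probability T R) (n : nat) (A : nat -> set T) : \bar R :=
  (\int[P1]_(x in A 0%N) rchain p A 1 n.-1 x)%E.

(* Pn is the joint law P^{(n)}(dx) = p(dx_n|x_{n-1}) ... p(dx_2|x_1) P1(dx_1)
   (a probability measure on X^n is determined by its values on measurable
   rectangles). *)
Definition is_joint_law {dT} {T : measurableType dT} (P1 : probability T R)
    (p : T -> probability T R) (n : nat) (Pn : probability (n.-tuple T) R) : Prop :=
  forall A : nat -> set T, (forall i, measurable (A i)) ->
    Pn [set x | forall i : 'I_n, A i (tnth x i)] = joint_rect P1 p n A.

End defs.

(* Main.v *)
Require Import Defs.
From HB Require Import structures.
From mathcomp Require Import all_boot all_order all_algebra.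
From mathcomp Require Import all_classical all_reals all_analysis measurable_realfun.
From mathcomp Require Import giry ring lra.
Import Order.TTheory GRing.Theory Num.Theory.
Local Open Scope classical_set_scope.
Local Open Scope ring_scope.

(** Backward induction along the chain.  Let [K_m x] be the law of the next [m]
    states after [x], and put [a_m = 1 + L + ... + L^(m-1)].  For [F] 1-Lipschitz
    on [X^(m+1)], averaging out all coordinates but the first gives
    [g x = \int F (x, z) K_m(dz | x)].  Changing [x] to [y] moves the integrand by
    at most [d x y] and the mean under [K_m] by at most [L * a_m * d x y], so [g]
    is [a_(m+1)]-Lipschitz because [1 + L * a_m = a_(m+1)].  Concentration of [K_m]
    inside, then of the one-step law applied to [g], adds [kappa1 * a_(m+1)^2] to
    the constant.  The mean bound propagates through the easy half of
    Kantorovich duality, [\int g dp(x) - \int g dp(y) <= a_(m+1) * W1]. *)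

(** * Measurability of Lipschitz functions and of the metric *)

Definition dense_seq {R : realType} {T : Type} (d : T -> T -> R) (u : nat -> T) :=
  forall x (e : R), 0 < e -> exists k, d x (u k) < e.

Section measurable_lipschitz.
Context {R : realType}.

(* McShane: [F] is the infimum of [F (u k) + c * d x (u k)] over [k]. *)
Lemma measurable_lipschitz {dT} {T : measurableType dT} (d : T -> T -> R)
    (u : nat -> T) (c : R) (F : T -> R) :
  (forall y, measurable_fun setT (d^~ y)) -> dense_seq d u ->
  0 <= c -> lipschitz_wrt d c F -> measurable_fun setT F.
Proof.
move=> md du c0 lipF.
apply: (measurability _ (RGenInftyO.measurableE R)) => _ [_ [a ->] <-].
rewrite setTI.
have -> : F @^-1` `]-oo, a[ =
    \bigcup_k ((fun x => F (u k) + c * d x (u k)) @^-1` `]-oo, a[).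
  apply/seteqP; split => x /=; rewrite in_itv/=.
    (* The competitor at [u k] exceeds [F x] by at most [2 * c * d x (u k)]; the extra 1 keeps the
       denominator positive when [c = 0]. *)
    move=> Fxa; have c1 : 0 < 2 * c + 1 by lra.
    have [|k dk] := du x ((a - F x) / (2 * c + 1)).
      by rewrite divr_gt0// subr_gt0.
    exists k => //=; rewrite in_itv/=.
    move: dk; rewrite ltr_pdivlMr// => dk.
    have := lipF x (u k); rewrite ler_norml => /andP[+ _].
    (* No metric axiom is assumed at this point, so the sign of [d] is open; a negative value forces
       [c * d x (u k) = 0] by the Lipschitz bound. *)
    have d0 : 0 <= d x (u k) \/ d x (u k) < 0.
      by case: (lerP 0 (d x (u k))); [left|right].
    have := lipF x (u k); move/(le_trans (normr_ge0 _)) => cd0 h.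
    case: d0 => d0; nra.
  move=> [k _ /=]; rewrite in_itv/=; apply: le_lt_trans.
  by have := lipF x (u k); rewrite ler_norml => /andP[]; lra.
apply: bigcupT_measurable => k; rewrite -[X in measurable X]setTI.
apply: measurable_funD => //; first exact: measurable_funM.
Qed.

Context {dX} {X : measurableType dX} (d : X -> X -> R).
Hypotheses (metric_d : is_metric d) (borel_d : @measurable _ X = <<s d_open d >>).

Lemma dist_refl x : d x x = 0.
Proof. by have [h _ _] := metric_d; apply/h. Qed.

Lemma dist_sym x y : d x y = d y x.
Proof. by have [] := metric_d. Qed.

Lemma dist_triangle y x z : d x z <= d x y + d y z.
Proof. by have [] := metric_d. Qed.

Lemma dist_ge0 x y : 0 <= d x y.
Proof. by have := dist_triangle y x x; rewrite dist_refl (dist_sym y x); lra. Qed.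

Lemma measurable_dist y : measurable_fun setT (d^~ y).
Proof.
apply: (measurability _ (RGenInftyO.measurableE R)) => _ [_ [a ->] <-].
rewrite setTI borel_d; apply: sub_sigma_algebra => x /=; rewrite in_itv/= => xa.
exists (a - d x y); rewrite subr_gt0; split => // z /=; rewrite in_itv/=.
by have := dist_triangle x z y; rewrite (dist_sym z x); lra.
Qed.

Lemma separable_dense_seq : d_separable d -> exists u, dense_seq d u.
Proof.
move=> [D [cD dD]].
(* [X] is pointed, so [D] comes close to [point]; this excludes the empty case of the
   enumeration. *)
have : D !=set0 by have [y [Dy _]] := dD point 1 ltr01; exists y.
move: cD; rewrite /countable => /pfcard_geP[->[]//|[f] _].
exists f => x e /(dD x)[y [Dy dxy]].
by have [n _ fn] := @surj _ _ _ _ f y Dy; exists n; rewrite fn.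
Qed.

Context {u : nat -> X} (du : dense_seq d u).

(** Tuples of indices are countable: [k] is decoded into such a tuple, and non-codes get a dummy
    value. *)
Lemma dense_seq_tuple m : exists v, dense_seq (@dsum R X d m) v.
Proof.
exists (fun k => if unpickle k is Some t then map_tuple u t : m.-tuple X
  else [tuple of nseq m point]).
move=> x e e0.
(* Dividing by [m.+1] makes the sum of [m] errors strictly less than [e] and also covers [m = 0]. *)
have em : 0 < e / m.+1%:R by rewrite divr_gt0.
have /choice[h hh] : forall i : 'I_m, exists k, d (tnth x i) (u k) < e / m.+1%:R.
  by move=> i; exact: du.
exists (pickle [tuple h i | i < m]); rewrite pickleK /dsum.
apply: (@le_lt_trans _ _ (\sum_(i < m) e / m.+1%:R)).
  by apply: ler_sum => i _; rewrite tnth_map tnth_mktuple; exact/ltW.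
rewrite sumr_const card_ord -[_ *+ m]mulr_natr mulrAC ltr_pdivrMr//.
by rewrite ltr_pM2l// ltr_nat.
Qed.

Lemma measurable_dsum m (y : m.-tuple X) : measurable_fun setT ((@dsum R X d m)^~ y).
Proof.
rewrite /dsum; apply: (@measurable_sum _ _ R setT 'I_m) => i.
exact: (measurableT_comp (measurable_dist (tnth y i)) (measurable_tnth i)).
Qed.

(** Tuples carry the product sigma-algebra, not by definition the Borel one of [dsum]; the countable
    dense set bridges the two. *)
Lemma measurable_lipschitz_tuple m (F : m.-tuple X -> R) :
  lipschitz_wrt (@dsum R X d m) 1 F -> measurable_fun setT F.
Proof.
have [v dv] := dense_seq_tuple m.
by apply: measurable_lipschitz dv _ => //; exact: measurable_dsum.
Qed.

(** Makes the transport cost integrable against couplings in the extended sense: [d] is 1-Lipschitz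
    for the sum distance on pairs, where pairs of points of [u] are dense. *)
Lemma measurable_dist2 : measurable_fun setT (fun z : X * X => d z.1 z.2).
Proof.
pose d2 (z w : X * X) := d z.1 w.1 + d z.2 w.2.
apply: (@measurable_lipschitz _ _ d2
  (fun k => if unpickle k is Some ij then (u ij.1, u ij.2) else point) 1) => //.
- move=> w; apply: measurable_funD.
    exact: (measurableT_comp (measurable_dist w.1) measurable_fst).
  exact: (measurableT_comp (measurable_dist w.2) measurable_snd).
- move=> z e e0; have e2 : 0 < e / 2 by lra.
  have [i hi] := du z.1 _ e2; have [j hj] := du z.2 _ e2.
  by exists (pickle (i, j)); rewrite pickleK /d2/=; lra.
- move=> z w; rewrite ler_norml mul1r /d2.
  have := dist_triangle w.1 z.1 z.2; have := dist_triangle w.2 w.1 z.2.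
  have := dist_triangle z.1 w.1 w.2; have := dist_triangle z.2 z.1 w.2.
  by rewrite (dist_sym w.1 z.1) (dist_sym w.2 z.2); lra.
Qed.

End measurable_lipschitz.

(** * Laws of a head followed by a tail drawn from a kernel *)

Section splice.
Context {R : realType} {dX} {X : measurableType dX}.

Lemma measurable_integral_kernel {dY} {Y : measurableType dY}
    (K : X -> probability Y R) (f : X * Y -> \bar R) :
  (forall A, measurable A -> measurable_fun setT (fun x => K x A : \bar R)) ->
  measurable_fun setT f -> (forall z, 0 <= f z)%E ->
  measurable_fun setT (fun x => \int[K x]_y f (x, y))%E.
Proof.
move=> mK mf f0.
(* The bare family [K] is bundled as a probability kernel, the structure to which the measurability
   theorem applies. *)
pose k0 : X -> {measure set Y -> \bar R} := K.
pose m0 := isKernel.Build _ _ X Y R k0 mK.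
pose k1 : kernel X Y R := HB.pack k0 m0.
have k1T x : k1 x setT = 1%E by exact: probability_setT.
pose m1 := Kernel_isProbability.Build _ _ X Y R k1 k1T.
pose k2 : probability_kernel X Y R := HB.pack k0 m0 m1.
exact: (measurable_fun_integral_finite_kernel f k2).
Qed.

(* [Q] is the law of [x :: z] with [x] drawn from [mu], then [z] from [K x]. *)
Definition splice {m} (Q : probability (m.+1.-tuple X) R) (mu : probability X R)
    (K : X -> probability (m.-tuple X) R) :=
  forall f : m.+1.-tuple X -> \bar R, measurable_fun setT f ->
    (forall z, 0 <= f z)%E ->
    (\int[Q]_z f z = \int[mu]_x \int[K x]_z f (cons_tuple x z))%E.

Lemma measurable_cons_pair m :
  measurable_fun setT (fun z : X * m.-tuple X => cons_tuple z.1 z.2).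
Proof. exact: (measurable_cons measurable_fst measurable_snd). Qed.

Lemma measurable_cons_tuple m (x : X) :
  measurable_fun setT (fun z : m.-tuple X => cons_tuple x z).
Proof. exact: (measurable_cons (measurable_cst x) (@measurable_id _ _ setT)). Qed.

Context {m : nat} (K : X -> probability (m.-tuple X) R).
Hypothesis mK :
  forall A, measurable A -> measurable_fun setT (fun x => K x A : \bar R).

Lemma measurable_integral_cons (f : m.+1.-tuple X -> \bar R) :
  measurable_fun setT f -> (forall z, 0 <= f z)%E ->
  measurable_fun setT (fun x => \int[K x]_z f (cons_tuple x z))%E.
Proof.
move=> mf f0.
apply: (@measurable_integral_kernel _ _ K (fun z => f (cons_tuple z.1 z.2))) => //.
exact: (measurableT_comp mf (@measurable_cons_pair m)).
Qed.

Lemma measurable_kernel_cons (A : set (m.+1.-tuple X)) : measurable A ->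
  measurable_fun setT
    (fun x => K x (cons_tuple x @^-1` A) : \bar R).
Proof.
move=> mA.
have := @measurable_integral_cons (fun z => (\1_A z)%:E).
rewrite (_ : (fun x => \int[K x]_z _)%E =
    (fun x => K x (cons_tuple x @^-1` A) : \bar R)); last first.
  apply/funext => x.
  rewrite -[X in _ = K x X]setIT -integral_indic//.
  by rewrite -[X in measurable X]setTI; exact: measurable_cons_tuple.
by apply => [|z]; [exact/measurable_EFinP/measurable_indic|rewrite lee_fin].
Qed.

(** This is the Giry bind of [mu] with the image of [K x] under prepending [x]. *)
Lemma exists_splice (mu : probability X R) : exists Q, splice Q mu K.
Proof.
pose kap x : giry (m.+1.-tuple X) R := giry_map (@measurable_cons_tuple m x) (K x).
have mkap : measurable_fun setT kap.
  by apply: measurable_giry_codensity => // B mB; exact: measurable_kernel_cons.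
pose Q0 := giry_bind (mu : giry X R) mkap.
have Q0E f : measurable_fun setT f -> (forall z, 0 <= f z)%E ->
    (\int[Q0]_z f z = \int[mu]_x \int[K x]_z f (cons_tuple x z))%E.
  move=> mf f0; rewrite -[LHS]/(giry_int Q0 f) giry_int_bind//.
  by apply: eq_integral => x _; rewrite giry_int_map.
(* The bind only yields a subprobability; integrating the constant 1 shows that no mass is lost. *)
have Q0T : Q0 setT = 1%E.
  rewrite -[LHS]mul1e -integral_cst// Q0E//.
  under eq_integral do rewrite integral_cst//= mul1e probability_setT.
  by rewrite integral_cst// mul1e; exact: (probability_setT mu).
pose mQ := isProbability.Build _ _ _ (SubProbability.sort Q0) Q0T.
pose Q : probability (m.+1.-tuple X) R := HB.pack (SubProbability.sort Q0) mQ.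
by exists Q.
Qed.

Lemma splice_setE mu Q (A : set (m.+1.-tuple X)) : splice Q mu K -> measurable A ->
  Q A = (\int[mu]_x K x (cons_tuple x @^-1` A))%E.
Proof.
move=> QE mA; rewrite -[X in Q X]setIT -integral_indic// QE => [|//|z]; last first.
- by rewrite lee_fin.
- exact/measurable_EFinP/measurable_indic.
apply: eq_integral => x _.
rewrite -[X in _ = K x X]setIT -integral_indic//.
by rewrite -[X in measurable X]setTI; exact: measurable_cons_tuple.
Qed.

Lemma splice_integral mu Q (f : m.+1.-tuple X -> \bar R) : splice Q mu K ->
  Q.-integrable setT f ->
  (\int[Q]_z f z = \int[mu]_x \int[K x]_z f (cons_tuple x z))%E.
Proof.
move=> QE intf; have mf := measurable_int _ intf.
rewrite integralE !QE//; last 2 first.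
- exact: measurable_funeneg.
- exact: measurable_funepos.
(* Integrability of both outer integrals allows their difference to be merged into one. *)
have fin (h : m.+1.-tuple X -> \bar R) : (forall z, 0 <= h z)%E -> Q.-integrable setT h ->
    mu.-integrable setT (fun x => \int[K x]_z h (cons_tuple x z))%E.
  move=> h0 ih; have mh := measurable_int _ ih.
  apply/integrableP; split; first exact: measurable_integral_cons.
  under eq_integral do rewrite gee0_abs ?integral_ge0//.
  by rewrite -QE//; exact: integrable_lty.
rewrite -integralB//; last 2 first.
- by apply: fin => //; exact: integrable_funepos.
- by apply: fin => //; exact: integrable_funeneg.
(* This holds for every [x], even where an inner integral is infinite, because an integral is by
   definition the difference of those of its two parts. *)
apply: eq_integral => x _; rewrite [RHS]integralE.
by congr (_ - _)%E; apply: eq_integral => z _; rewrite ?funeposE ?funenegE.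
Qed.

End splice.

(** * Concentration for rescaled functions, and the Wasserstein bound on means *)

Section gc.
Context {R : realType}.

(** Concentration is applied to [F / c] at parameter [c * t], whence the factor [c ^+ 2]. *)
Lemma GC_lipschitz {dT} {T : measurableType dT} (d : T -> T -> R) (kappa c : R)
    (mu : probability T R) (F : T -> R) : 0 < c ->
  GC d kappa mu -> lipschitz_wrt d c F ->
  mu.-integrable setT (EFin \o F) /\
  forall t : R, (\int[mu]_x (expR (t * F x))%:E <=
    (expR (t * \int[mu]_x F x + kappa * c ^+ 2 * t ^+ 2 / 2))%:E)%E.
Proof.
move=> c0 gc lipF.
have cN0 : c != 0 by rewrite gt_eqF.
have [|intG expG] := gc (fun x => c^-1 * F x).
  move=> x y; rewrite -mulrBr normrM gtr0_norm ?invr_gt0// mul1r.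
  by rewrite mulrC ler_pdivrMr// mulrC.
have intF : mu.-integrable setT (EFin \o F).
  have := integrableZl measurableT c intG.
  by apply: eq_integrable => // x _ /=; rewrite -EFinM mulrA divff// mul1r.
split => // t; have := expG (c * t); rewrite -/(Rintegral mu setT _) RintegralZl//.
rewrite (_ : c * t * (c^-1 * \int[mu]_x F x) = t * \int[mu]_x F x); last by field.
rewrite (_ : kappa * (c * t) ^+ 2 / 2 = kappa * c ^+ 2 * t ^+ 2 / 2); last by field.
apply: le_trans; rewrite le_eqVlt; apply/orP; left; apply/eqP.
by apply: eq_integral => x _; congr (expR _)%:E; field.
Qed.

Lemma normr_le_expRD (x : R) : `|x| <= expR x + expR (- x).
Proof.
have := expR_ge1Dx x; have := expR_ge1Dx (- x).
have := expR_gt0 x; have := expR_gt0 (- x).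
by rewrite ler_norml => *; apply/andP; split; lra.
Qed.

(** Exponential moments at [t = 1] and [t = -1] dominate [|F|]; this supplies the integrability
    clause of [GC]. *)
Lemma integrable_expR {dT} {T : measurableType dT} (mu : probability T R)
    (F : T -> R) : measurable_fun setT F ->
  (forall t : R, (\int[mu]_x (expR (t * F x))%:E < +oo)%E) ->
  mu.-integrable setT (EFin \o F).
Proof.
move=> mF h; apply/integrableP; split; first exact/measurable_EFinP.
have mE t : measurable_fun setT (fun x => (expR (t * F x))%:E).
  by apply/measurable_EFinP; apply: measurableT_comp => //; exact: measurable_funM.
apply: (@le_lt_trans _ _
    (\int[mu]_x ((expR (1 * F x))%:E + (expR (-1 * F x))%:E))%E).
  apply: ge0_le_integral => //.
  - by apply: measurableT_comp => //; exact/measurable_EFinP.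
  - by apply: emeasurable_funD; exact: mE.
  - by move=> x _; rewrite -EFinD lee_fin mul1r mulN1r; exact: normr_le_expRD.
by rewrite ge0_integralD//; exact: lte_add_pinfty.
Qed.

Context {dX} {X : measurableType dX} (d : X -> X -> R).
Hypotheses (metric_d : is_metric d) (borel_d : @measurable _ X = <<s d_open d >>).
Context {u : nat -> X} (du : dense_seq d u).

Lemma pushforward_Rintegral (mu : probability X R) (pi : probability (X * X)%type R)
    (phi : X * X -> X) (g : X -> R) : measurable_fun setT phi ->
  (forall A, measurable A -> pi (phi @^-1` A) = mu A) ->
  mu.-integrable setT (EFin \o g) ->
  pi.-integrable setT (EFin \o (g \o phi)) /\
  \int[pi]_z g (phi z) = \int[mu]_x g x.
Proof.
move=> mphi pim intg; have mg := measurable_int _ intg.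
have E h : measurable_fun setT h -> (forall x, 0 <= h x)%E ->
    (\int[pi]_z h (phi z) = \int[mu]_x h x)%E.
  move=> mh h0; rewrite -[LHS](@ge0_integral_pushforward _ _ _ _ _ _ mphi pi setT)//.
  by apply: (eq_measure_integral mu) => A mA _; exact: pim.
split.
  apply/integrableP; split; first exact: (measurableT_comp mg mphi).
  rewrite (E (fun x => `|(g x)%:E|%E))//; first by have /integrableP[] := intg.
  exact: measurableT_comp.
congr fine; rewrite [LHS]integralE [RHS]integralE; congr (_ - _)%E.
- rewrite -E//; last exact: measurable_funepos.
  by apply: eq_integral => z _; rewrite !funeposE.
- rewrite -E//; last exact: measurable_funeneg.
  by apply: eq_integral => z _; rewrite !funenegE.
Qed.

(** After division by [c] the claim is a lower bound for an infimum, so it is checked on each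
    coupling, where [g z.1 - g z.2] is at most [c * d z.1 z.2] in absolute value. *)
Lemma W1_lipschitz (mu nu : probability X R) (c w : R) (g : X -> R) :
  0 < c -> lipschitz_wrt d c g ->
  mu.-integrable setT (EFin \o g) -> nu.-integrable setT (EFin \o g) ->
  (W1 d mu nu <= w%:E)%E ->
  `| \int[mu]_x g x - \int[nu]_x g x | <= c * w.
Proof.
move=> c0 lipg imu inu; rewrite -ler_pdivrMl// -lee_fin; apply: le_trans.
apply: le_ereal_inf_tmp => _ [pi [pi1 pi2] <-].
have fstE A : measurable A -> pi (fst @^-1` A) = mu A.
  by move=> mA; rewrite -pi1// setXT.
have sndE A : measurable A -> pi (snd @^-1` A) = nu A.
  by move=> mA; rewrite -pi2// setTX.
have [i1 e1] := pushforward_Rintegral _ _ _ _ measurable_fst fstE imu.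
have [i2 e2] := pushforward_Rintegral _ _ _ _ measurable_snd sndE inu.
rewrite -e1 -e2 -RintegralB//.
have iB : pi.-integrable setT (EFin \o (fun z => g z.1 - g z.2)).
  by apply: eq_integrable (integrableB measurableT i1 i2) => // z _.
rewrite EFinM EFin_normr_Rintegral// lee_pdivrMl//.
apply: le_trans (le_abse_integral _ _ _) _ => //; first exact: measurable_int iB.
have md2 := measurable_dist2 d metric_d borel_d du.
have d0 := dist_ge0 d metric_d.
rewrite -ge0_integralZl//; last 3 first.
- exact/measurable_EFinP.
- by move=> z _; rewrite lee_fin.
- by rewrite lee_fin ltW.
apply: ge0_le_integral => //.
- by apply: measurableT_comp => //; exact: measurable_int iB.
- by apply/measurable_EFinP/measurable_funM.
- by move=> z _; rewrite -EFinM lee_fin; exact: lipg.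
Qed.

End gc.

(** * The induction step: concentration of a spliced law *)

Section gc_splice.
Context {R : realType} {dX} {X : measurableType dX} (d : X -> X -> R).
Hypotheses (metric_d : is_metric d) (borel_d : @measurable _ X = <<s d_open d >>).
Context {u : nat -> X} (du : dense_seq d u).

Lemma dsum_cons m (x x' : X) (z z' : m.-tuple X) :
  dsum d (cons_tuple x z) (cons_tuple x' z') = d x x' + dsum d z z'.
Proof.
rewrite /dsum big_ord_recl; congr (_ + _).
by apply: eq_bigr => i _; rewrite !tnthS.
Qed.

Lemma dsum_refl m (z : m.-tuple X) : dsum d z z = 0.
Proof. by rewrite /dsum big1// => i _; rewrite dist_refl. Qed.

Lemma lipschitz_cons m (F : m.+1.-tuple X -> R) (x : X) :
  lipschitz_wrt (@dsum R X d m.+1) 1 F ->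
  lipschitz_wrt (@dsum R X d m) 1 (fun z => F (cons_tuple x z)).
Proof.
move=> lipF z z'; apply: le_trans (lipF _ _) _.
by rewrite dsum_cons dist_refl// add0r.
Qed.

Context {m : nat} {K : X -> probability (m.-tuple X) R}.
Hypothesis mK :
  forall A, measurable A -> measurable_fun setT (fun x => K x A : \bar R).
Context {kappa b : R} (b0 : 0 <= b).
Hypothesis GCK : forall x, GC (@dsum R X d m) kappa (K x).
Hypothesis mean_lipschitz : forall F : m.-tuple X -> R,
  lipschitz_wrt (@dsum R X d m) 1 F ->
  forall x y, `| \int[K x]_z F z - \int[K y]_z F z | <= b * d x y.

Section mean.
Context {F : m.+1.-tuple X -> R} (lipF : lipschitz_wrt (@dsum R X d m.+1) 1 F).

Let g x := \int[K x]_z F (cons_tuple x z).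

Let intK y x : (K y).-integrable setT (EFin \o (fun z => F (cons_tuple x z))).
Proof. by have [] := GCK y _ (lipschitz_cons _ _ x lipF). Qed.

Lemma lipschitz_mean_cons : lipschitz_wrt d (1 + b) g.
Proof.
move=> x y; rewrite mulrDl mul1r.
(* The mean of [F (cons_tuple y z)] under [K x] is inserted: the first difference changes only the
   head, the second only the law of the tail. *)
have -> : g x - g y =
    (\int[K x]_z (F (cons_tuple x z) - F (cons_tuple y z))) +
    (\int[K x]_z F (cons_tuple y z) - \int[K y]_z F (cons_tuple y z)).
  by rewrite RintegralB; [rewrite addrA subrK|by []|exact: (intK x x)|exact: (intK x y)].
apply: le_trans (ler_normD _ _) _; apply: lerD; last first.
  exact/mean_lipschitz/lipschitz_cons.
have iB : (K x).-integrable setT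
    (EFin \o (fun z => F (cons_tuple x z) - F (cons_tuple y z))).
  by apply: eq_integrable (integrableB measurableT (intK x x) (intK x y)).
apply: le_trans (le_normr_Rintegral _ _) _ => //.
have -> : d x y = \int[K x]_z (d x y).
  by rewrite Rintegral_cst// [X in fine X](probability_setT (K x)) mulr1.
apply: le_Rintegral => //.
- exact: integrable_norm.
- exact: finite_measure_integrable_cst.
- move=> z _; apply: le_trans (lipF _ _) _.
  by rewrite dsum_cons dsum_refl addr0 mul1r.
Qed.

Context {kappa1 : R} {mu : probability X R} (GCmu : GC d kappa1 mu).
Context {Q : probability (m.+1.-tuple X) R} (QE : splice Q mu K).

(** Only nonnegative integrands are disintegrated, so the bound, centred at the mean of [g], comes
    before integrability of [F]. It then yields that integrability, and with it the equality of the
    centre with the mean of [F]. *)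
Lemma splice_mgf (t : R) : (\int[Q]_z (expR (t * F z))%:E <=
  (expR (t * \int[mu]_x g x + (kappa + kappa1 * (1 + b) ^+ 2) * t ^+ 2 / 2))%:E)%E.
Proof.
have mF := measurable_lipschitz_tuple d metric_d borel_d du _ _ lipF.
have mE : measurable_fun setT (fun z => (expR (t * F z))%:E).
  by apply/measurable_EFinP; apply: measurableT_comp => //; exact: measurable_funM.
have b1 : 0 < 1 + b by rewrite ltr_pwDl.
have [ig expg] := GC_lipschitz d kappa1 (1 + b) mu g b1 GCmu lipschitz_mean_cons.
have mg : measurable_fun setT g by apply/measurable_EFinP; exact: measurable_int ig.
have mEg : measurable_fun setT (fun x => (expR (t * g x))%:E).
  by apply/measurable_EFinP; apply: measurableT_comp => //; exact: measurable_funM.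
rewrite QE//.
(* Inner step: concentration of [K x] at fixed head costs [kappa] and leaves [expR (t * g x)]. *)
apply: (@le_trans _ _ (\int[mu]_x ((expR (kappa * t ^+ 2 / 2))%:E * (expR (t * g x))%:E))%E).
  apply: ge0_le_integral => //.
  - by move=> x _; apply: integral_ge0 => z _; rewrite lee_fin expR_ge0.
  - by apply: (measurable_integral_cons _ mK (fun z => (expR (t * F z))%:E)).
  - by apply: measurable_funeM.
  - move=> x _; rewrite -EFinM -expRD addrC.
    by have [_] := GCK x _ (lipschitz_cons _ _ x lipF); apply.
rewrite ge0_integralZl//.
(* Outer step: [g] is [(1 + b)]-Lipschitz, so concentration of [mu] costs
   [kappa1 * (1 + b) ^+ 2]. *)
apply: (@le_trans _ _ ((expR (kappa * t ^+ 2 / 2))%:E *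
  (expR (t * \int[mu]_x g x + kappa1 * (1 + b) ^+ 2 * t ^+ 2 / 2))%:E)%E).
  by apply: lee_wpmul2l => //; rewrite lee_fin expR_ge0.
rewrite -EFinM -expRD lee_fin ler_expR; lra.
Qed.

Lemma splice_integrable : Q.-integrable setT (EFin \o F).
Proof.
apply: integrable_expR; first exact: (measurable_lipschitz_tuple d metric_d borel_d du _ _ lipF).
by move=> t; exact: le_lt_trans (splice_mgf t) (ltry _).
Qed.

Lemma splice_mean : \int[Q]_z F z = \int[mu]_x g x.
Proof.
congr fine; rewrite (splice_integral _ mK _ _ _ QE splice_integrable).
by apply: eq_integral => x _; rewrite /g /Rintegral fineK//; exact: (integrable_fin_num _ (intK x x)).
Qed.

End mean.

Lemma GC_splice (kappa1 : R) (mu : probability X R) (Q : probability (m.+1.-tuple X) R) :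
  GC d kappa1 mu -> splice Q mu K ->
  GC (@dsum R X d m.+1) (kappa + kappa1 * (1 + b) ^+ 2) Q.
Proof.
move=> GCmu QE F lipF; split; first exact: splice_integrable lipF _ _ GCmu _ QE.
move=> t; rewrite -/(Rintegral Q setT _) (splice_mean lipF GCmu QE).
exact: splice_mgf.
Qed.

End gc_splice.

(** * Measurable rectangles in the space of tuples *)

Section rectangle.
Context {R : realType} {dX} {X : measurableType dX}.

(* The offset [j] matches the index shift in the recursion of [rchain]. *)
Definition rectangle (A : nat -> set X) (j m : nat) : set (m.-tuple X) :=
  [set z | forall i : 'I_m, A (j + i)%N (tnth z i)].

Lemma measurable_rectangle A j m :
  (forall i, measurable (A i)) -> measurable (rectangle A j m).
Proof.
move=> mA.
have -> : rectangle A j m =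
    \bigcap_(i in [set: 'I_m]) ((@tnth m X)^~ i @^-1` A (j + i)%N).
  by apply/seteqP; split => [z h i _|z h i]; [exact: h|exact: (h i I)].
apply: fin_bigcap_measurable => // i _.
by rewrite -[X in measurable X]setTI; exact: measurable_tnth.
Qed.

Lemma rectangle_cons A j m x :
  cons_tuple x @^-1` rectangle A j m.+1 =
  if x \in A j then rectangle A j.+1 m else set0.
Proof.
case: ifPn => [/set_mem|] Ax; apply/seteqP; split => // z /= h.
- by move=> i; have := h (lift ord0 i); rewrite tnthS lift0 addnS.
- move=> i; case: (unliftP ord0 i) => [k|] ->; last by rewrite addn0.
  by rewrite tnthS lift0 addnS; exact: h.
- by have := h ord0; rewrite addn0 => /mem_set; rewrite (negbTE Ax).
Qed.

(** Rectangles are stable under intersection and generate the sigma-algebra, so they determine a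
    probability. *)
Lemma measure_eq_rectangle m (P Q : probability (m.-tuple X) R) :
  (forall A, (forall i, measurable (A i)) ->
    P (rectangle A 0 m) = Q (rectangle A 0 m)) ->
  forall B, measurable B -> P B = Q B.
Proof.
move=> PQ B mB.
pose G := [set rectangle A 0 m | A in [set A | forall i, measurable (A i)]].
have GT : G setT by exists (fun=> setT) => //; apply/seteqP; split.
apply: (g_sigma_algebra_measure_unique G _ (fun=> setT)) => //.
- by move=> _ [A mA <-]; exact: measurable_rectangle.
- by rewrite bigcup_const.
- move=> _ _ [A mA <-] [A' mA' <-]; exists (fun i => A i `&` A' i).
    by move=> i; exact: measurableI.
  by apply/seteqP; split => [z h|z [h h'] i]; split => // i; have [] := h i.
- by move=> _ [A mA <-]; exact: PQ.
- by move=> _; rewrite ltey_eq fin_num_measure.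
(* Each generator is a coordinate preimage, that is, a rectangle whose other sides are [setT]. *)
- move: B mB; apply: smallest_sub; first exact: smallest_sigma_algebra.
  move=> C; rewrite -bigcup_seq => -[i _ [D mD <-]]; apply: sub_gen_smallest.
  exists (fun k => if k == nat_of_ord i then D else setT).
    by move=> k /=; case: ifP.
  apply/seteqP; split => [z /(_ i)|z [_ h] k]; first by rewrite add0n eqxx.
  by rewrite add0n; case: eqP => // /val_inj ->.
Qed.

(** Slicing at the head leaves the tail rectangle or the empty set, which is exactly the recursion
    of [rchain]. *)
Lemma splice_rectangle m (K : X -> probability (m.-tuple X) R)
    (p : X -> probability X R) (mu : probability X R) Q A j :
  (forall i, measurable (A i)) ->
  (forall x, K x (rectangle A j.+1 m) = rchain p A j.+1 m x) ->
  splice Q mu K ->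
  Q (rectangle A j m.+1) = (\int[mu]_(x in A j) rchain p A j.+1 m x)%E.
Proof.
move=> mA KE QE.
rewrite (splice_setE _ _ _ _ QE); last exact: measurable_rectangle.
rewrite [RHS]integral_mkcond; apply: eq_integral => x _.
by rewrite rectangle_cons patchE; case: ifP => _; rewrite ?KE ?measure0.
Qed.

End rectangle.

(** * Induction along the chain and identification of the joint law *)

Lemma dirac_GC (R : realType) dX (X : measurableType dX) (d : X -> X -> R) :
  GC (@dsum R X d 0) 0 (\d_([tuple] : 0.-tuple X)).
Proof.
move=> F _.
have FE : F = cst (F [tuple]) by apply/funext => z; rewrite tuple0.
rewrite FE; split; first exact: finite_measure_integrable_cst.
have intE (r : R) : (\int[\d_([tuple] : 0.-tuple X)]_z r%:E = r%:E)%E.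
  by rewrite integral_cst//= diracT mule1.
by move=> t; rewrite /= !intE /= !mul0r addr0.
Qed.

Section chain.
Context {R : realType} {dX} {X : measurableType dX} (d : X -> X -> R).
Hypotheses (metric_d : is_metric d) (borel_d : @measurable _ X = <<s d_open d >>).
Context {u : nat -> X} (du : dense_seq d u).
Context (p : X -> probability X R) (kappa1 L : R) (L0 : 0 <= L).
Hypothesis mp :
  forall A, measurable A -> measurable_fun setT (fun x => p x A : \bar R).
Hypothesis GCp : forall x, GC d kappa1 (p x).
Hypothesis lip_p : forall x y, (W1 d (p x) (p y) <= (L * d x y)%:E)%E.

Let a m : R := \sum_(0 <= k < m) L ^+ k.

Lemma geometric_sum_rec m :
  \sum_(0 <= k < m.+1) L ^+ k = 1 + L * \sum_(0 <= k < m) L ^+ k.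
Proof.
rewrite big_nat_recl// expr0 mulr_sumr; congr (_ + _).
by apply: eq_bigr => k _; rewrite exprS.
Qed.

(** Lipschitz dependence on the starting point is carried in dual form, through means of Lipschitz
    functions, so no Wasserstein distance on tuples appears. The rectangle values, for every offset
    [j], tie [K] to the joint law. *)
Lemma exists_chain m : exists K : X -> probability (m.-tuple X) R, [/\
  forall A, measurable A -> measurable_fun setT (fun x => K x A : \bar R),
  forall x, GC (@dsum R X d m) (kappa1 * \sum_(1 <= j < m.+1) a j ^+ 2) (K x),
  forall F, lipschitz_wrt (@dsum R X d m) 1 F ->
    forall x y, `| \int[K x]_z F z - \int[K y]_z F z | <= L * a m * d x y &
  forall A j x, (forall i, measurable (A i)) ->
    K x (rectangle A j m) = rchain p A j m x].
Proof.
have a0 k : 0 <= a k by apply: sumr_ge0 => i _; exact: exprn_ge0.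
elim: m => [|m [K [mK GCK lipK KE]]].
  (* [X^0] is one point, and its Dirac mass concentrates with constant 0, the value of the empty
     sum. *)
  exists (fun=> \d_([tuple] : 0.-tuple X)); split.
  - by move=> A mA; exact: measurable_cst.
  - by move=> _; rewrite big_geq// mulr0; exact: dirac_GC.
  - by move=> F _ x y; rewrite subrr normr0 /a big_geq// mulr0 mul0r.
  - move=> A j x _; rewrite (_ : rectangle _ _ _ = setT); first exact: diracT.
    by apply/seteqP; split => // z _ [].
have /choice[K' K'E] := fun x => exists_splice K mK (p x).
have b0 : 0 <= L * a m by rewrite mulr_ge0.
exists K'; split.
(* [K'] comes from choice, but the splice formula fixes its values on measurable sets, and that
   formula is measurable in the starting point. *)
- move=> A mA; under eq_fun do rewrite (splice_setE _ _ _ _ (K'E _) mA).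
  exact: (measurable_fun_integral_kernel mp _ (measurable_kernel_cons _ mK _ mA)).
- move=> x; rewrite big_nat_recr//= mulrDr /a geometric_sum_rec.
  exact: (GC_splice d metric_d borel_d du mK b0 GCK lipK _ _ _ (GCp x) (K'E x)).
(* Both means are means of one and the same [g], under [p x] and [p y], because the tail kernel [K]
   is common to the two. *)
- move=> F lipF x y.
  rewrite !(splice_mean d metric_d borel_d du mK b0 GCK lipK lipF (GCp _) (K'E _)).
  have b1 : 0 < 1 + L * a m by rewrite ltr_pwDl.
  have lipg := lipschitz_mean_cons d metric_d GCK lipK lipF.
  have ig z := (GC_lipschitz d kappa1 _ (p z) _ b1 (GCp z) lipg).1.
  rewrite {1}/a geometric_sum_rec -/(a m) (mulrC L) -mulrA.
  exact: (W1_lipschitz d metric_d borel_d du _ _ _ _ _ b1 lipg (ig x) (ig y) (lip_p x y)).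
- move=> A j x mA.
  by apply: (splice_rectangle _ _ _ _ _ _ _ mA _ (K'E x)) => y; exact: KE.
Qed.

End chain.

Theorem theorem1p1 (R : realType) (dX : measure_display) (X : measurableType dX)
  (d : X -> X -> R)
  (hmetric : is_metric d) (hcomplete : d_complete d) (hsep : d_separable d)
  (hborel : @measurable _ X = <<s d_open d >>)
  (P1 : probability X R) (p : X -> probability X R)
  (hkernel : forall A : set X, measurable A -> measurable_fun [set: X] (fun x : X => (p x A : \bar R)))
  (n : nat) (hn : (0 < n)%N) (Pn : probability (n.-tuple X) R)
  (hjoint : is_joint_law P1 p Pn)
  (kappa1 L : R) (hkappa1 : 0 < kappa1) (hL : 0 <= L)
  (hGC1 : GC d kappa1 P1) (hGCp : forall x, GC d kappa1 (p x))
  (hLip : forall x y, (W1 d (p x) (p y) <= (L * d x y)%:E)%E) :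
  GC (@dsum R X d n)
     (kappa1 * \sum_(1 <= m < n.+1) (\sum_(0 <= k < m) L ^+ k) ^+ 2)
     Pn.
Proof.
case: n hn Pn hjoint => // m _ Pn hjoint.
have [u du] := separable_dense_seq d hsep.
have [K [mK GCK lipK KE]] :=
  exists_chain d hmetric hborel du p kappa1 L hL hkernel hGCp hLip m.
have [Q QE] := exists_splice K mK P1.
have PnQ : forall B, measurable B -> Pn B = Q B.
  apply: measure_eq_rectangle => A mA.
  rewrite (splice_rectangle _ _ p _ _ _ _ mA _ QE); last by move=> x; exact: KE.
  exact: hjoint.
(* Integrals depend only on the values on measurable sets, so [Pn] inherits the disintegration of
   [Q]. *)
have PnE : splice Pn P1 K.
  move=> f mf f0; rewrite -QE//.
  by apply: (eq_measure_integral Q) => B mB _; exact: PnQ.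
have b0 : 0 <= L * \sum_(0 <= k < m) L ^+ k.
  by rewrite mulr_ge0// sumr_ge0// => i _; exact: exprn_ge0.
(* The summand of index [m.+1] is the contribution of [P1]; the others come from the [m] later
   states. *)
rewrite big_nat_recr//= mulrDr geometric_sum_rec.
exact: (GC_splice d hmetric hborel du mK b0 GCK lipK _ _ _ hGC1 PnE).
Qed.
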